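(* Let $\phi(x)=Ax$ with $A$ an injective matrix of size $K\times M$. Then the function $\mathcal{L}(x)=\mathbb{E}_{\epsilon\sim p(\epsilon_0)}\left[\|\phi(x+\epsilon)-\phi(y)\|^2\right]$, $x\in\mathbb{R}^M$, has a unique global minimizer, equal to $y-\mathbb{E}[\epsilon_0]$.
   Context: $A$ is a real matrix, so $\phi$ maps $\mathbb{R}^M$ to $\mathbb{R}^K$ (injectivity forces $K\ge M$). $\|\cdot\|$ is the Euclidean norm. $\epsilon_0$ is an $\mathbb{R}^M$-valued random vector (the noise) with distribution $p(\epsilon_0)$, and $\epsilon\sim p(\epsilon_0)$ means that $\epsilon$ has this distribution. $y\in\mathbb{R}^M$ is the observed vector, held fixed in the definition of $\mathcal{L}$. The general setting in which the result appears takes Gaussian white noise, $\epsilon_0\sim\mathcal{N}(0,\sigma^2 I_M)$, but the statement itself names no noise distribution, and its proof remarks that the result is independent of the noise distribution $p(\epsilon_0)$. *)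

(* Defs.v *)
From HB Require Import structures.
From mathcomp Require Import all_boot all_order all_algebra.
From mathcomp Require Import all_classical all_reals all_analysis.

Set Implicit Arguments.
Unset Strict Implicit.
Unset Printing Implicit Defensive.

Import Order.TTheory GRing.Theory Num.Theory.
Import numFieldNormedType.Exports.

Local Open Scope classical_set_scope.
Local Open Scope ring_scope.

(* R^n with its Borel sigma-algebra; the topology on matrices is the product
   topology, i.e. the usual topology of R^n. *)
Definition borel_cV (R : realType) (n : nat) :=
  g_sigma_algebraType (@open 'cV[R]_n).

(* The norm `|v| that MathComp-Analysis puts on matrices is the sup norm,
   hence this definition. *)
Definition l2norm (R : realType) (n : nat) (v : 'cV[R]_n) : R :=
  Num.sqrt (\sum_(i < n) v i 0 ^+ 2).

Definition phi (R : realType) (K M : nat) (A : 'M[R]_(K, M)) (x : 'cV[R]_M) :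
  'cV[R]_K := A *m x.

(* [fine] sends an infinite expectation to 0, so this is the mean vector only
   when the coordinates of [X] are integrable. *)
Definition mean_vec d (T : measurableType d) (R : realType)
    (P : probability T R) (M : nat) (X : {RV P >-> borel_cV R M}) : 'cV[R]_M :=
  \col_(i < M) fine 'E_P[fun w => (X w : 'cV[R]_M) i 0].

(* Valued in \bar R, so that no value is made up where the expectation of this
   nonnegative function is infinite. *)
Definition loss d (T : measurableType d) (R : realType) (P : probability T R)
    (K M : nat) (A : 'M[R]_(K, M)) (eps0 : {RV P >-> borel_cV R M})
    (y x : 'cV[R]_M) : \bar R :=
  'E_(distribution P eps0)[fun e : borel_cV R M =>
    l2norm (phi A (x + (e : 'cV[R]_M)) - phi A y) ^+ 2].

Definition global_minimizer (R : realType) (T : Type) (f : T -> \bar R)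
  (x : T) : Prop := forall z : T, (f x <= f z)%E.

(* Main.v *)
(** The K coordinates of [A (eps0 - (y - x))] are square-integrable real random
    variables, and for such a variable [Z] and a constant [c] one has
    [E (Z - c)^2 = Var Z + (E Z - c)^2].  Summing over the coordinates,
    [loss x] is a finite constant plus [|A (x - (y - E eps0))|^2], and the last
    term vanishes only at [x = y - E eps0] because [A] is injective. *)
Require Import Defs.
From HB Require Import structures.
From mathcomp Require Import all_boot all_order all_algebra.
From mathcomp Require Import all_classical all_reals all_analysis.
From mathcomp Require Import measurable_realfun ring.
Import Order.TTheory GRing.Theory Num.Theory.
Import numFieldNormedType.Exports.
Local Open Scope ring_scope.

Lemma l2norm_sqr (R : realType) (n : nat) (v : 'cV[R]_n) :
  l2norm v ^+ 2 = \sum_(i < n) v i 0 ^+ 2.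
Proof. by rewrite sqr_sqrtr// sumr_ge0// => i _; rewrite sqr_ge0. Qed.

Lemma l2norm_sqr_eq0 (R : realType) (n : nat) (v : 'cV[R]_n) :
  l2norm v ^+ 2 = 0 -> v = 0.
Proof.
rewrite l2norm_sqr => /eqP; rewrite psumr_eq0; last first.
  by move=> i _; rewrite sqr_ge0.
move=> /allP v0; apply/colP => i; apply/eqP; rewrite mxE -sqrf_eq0.
by apply: (implyP (v0 i (mem_index_enum _))).
Qed.

(** Coordinates are continuous, so open intervals, which generate the Borel sets of the line, pull
    back to open sets, the generators of [borel_cV]. *)
Lemma measurable_coord (R : realType) (n : nat) (i : 'I_n) :
  measurable_fun [set: borel_cV R n] (fun e : borel_cV R n => (e : 'cV[R]_n) i 0).
Proof.
apply: (measurability _ (RGenOpens.measurableE R)).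
move=> _ [_ [a [b ->] <-]]; rewrite setTI; apply: sub_sigma_algebra.
apply: (open_comp (f := fun M : 'cV[R]_n => M i 0)); last exact: interval_open.
by move=> M _; exact: coord_continuous.
Qed.

Section square_integrable.
Context d (T : measurableType d) (R : realType) (P : probability T R).

(** The norm behind [Lfun] integrates a real power of |f|, which at exponent 2 is [f w ^+ 2]. *)
Lemma sqr_expectation_Lfun2 (f : T -> R) : measurable_fun setT f ->
  ('E_P[fun w => (f w ^+ 2)%R] < +oo)%E -> f \in Lfun P 2%:E.
Proof.
rewrite unlock => mf f2; rewrite inE; apply/andP; split; rewrite inE//=.
rewrite /finite_norm unlock poweR_lty//; apply: le_lt_trans f2.
rewrite le_eqVlt; apply/orP; left; apply/eqP; apply: eq_integral => w _ /=.
by rewrite powR_mulrn// real_normK ?num_real.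
Qed.

Lemma Lfun2_Lfun1 (f : T -> R) : f \in Lfun P 2%:E -> f \in Lfun P 1.
Proof. by apply: Lfun_subset12; exact: fin_num_measure. Qed.

(** Variance is translation invariant, so Var f = E (f - c)^2 - (E f - c)^2; since E f is finite,
    the last square can be moved across in [\bar R]. *)
Lemma expectation_sqrB_cst (f : T -> R) (c : R) : f \in Lfun P 2%:E ->
  'E_P[fun w => ((f w - c) ^+ 2)%R]%E
  = ('V_P[f] + ((fine 'E_P[f] - c) ^+ 2)%:E)%E.
Proof.
move=> f2; have fc2 : (f \- cst c)%R \in Lfun P 2%:E.
  by rewrite rpredB ?lee1n//= => _; rewrite Lfun_cst.
have Efin : 'E_P[f]%E \is a fin_num by rewrite expectation_fin_num ?Lfun2_Lfun1.
rewrite -(varianceB_cst_r c f2) varianceE// expectationB ?Lfun2_Lfun1 ?Lfun_cst//.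
rewrite expectation_cst -(fineK Efin) -EFinB -EFin_expe subeK//.
Qed.

End square_integrable.

Theorem proposition2p1 (R : realType) (K M : nat) (A : 'M[R]_(K, M))
    (d : measure_display) (T : measurableType d) (P : probability T R)
    (eps0 : {RV P >-> borel_cV R M}) (y : 'cV[R]_M)
    (A_inj : injective (phi A))
    (eps0_L2 : ('E_P[fun w => (l2norm (eps0 w : 'cV[R]_M) ^+ 2)%R] < +oo)%E) :
  unique (global_minimizer (loss A eps0 y)) (y - mean_vec eps0).
Proof.
pose X i w := (eps0 w : 'cV[R]_M) i 0.
pose Z k w := (A *m (eps0 w : 'cV[R]_M)) k 0.
have mX i : measurable_fun setT (X i).
  exact: (measurableT_comp (measurable_coord R M i) (measurable_funPT eps0)).
(* A squared coordinate is at most the squared norm, whose expectation is finite by [eps0_L2]. *)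
have X2 i : X i \in Lfun P 2%:E.
  apply: sqr_expectation_Lfun2 => //; apply: le_lt_trans eps0_L2.
  apply: expectation_le => //.
  - exact: measurable_funX.
  - under eq_fun do rewrite l2norm_sqr.
    by apply: measurable_sum => j; exact: (measurable_funX 2 (mX j)).
  - by move=> w; rewrite sqr_ge0.
  - by move=> w; rewrite sqr_ge0.
  - apply/aeW => w; rewrite l2norm_sqr (bigD1 i)//= lerDl.
    by rewrite sumr_ge0// => j _; rewrite sqr_ge0.
(* As a linear combination of functions, [Z k] inherits square-integrability from the [X j], and its
   expectation splits by linearity. *)
have ZE k : Z k = \sum_j A k j \o* X j.
  apply/funext => w; rewrite /Z mxE fct_sumE.
  by apply: eq_bigr => j _; rewrite /= mulrC.
have Z2 k : Z k \in Lfun P 2%:E.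
  rewrite ZE rpred_sum ?lee1n//= => _ j _; apply: Lfun_scale => //.
  by rewrite ler1n.
have EZ k : fine 'E_P[Z k]%E = (A *m mean_vec eps0) k 0.
  (* [expectation_sum] ranges over a list of random variables, hence the reindexing. [fine] then
     passes through the sum and the products because every expectation is finite. *)
  rewrite ZE; rewrite -(big_map (fun j => A k j \o* X j) predT id) expectation_sum; last first.
    move=> _ /mapP[j _ ->]; apply: Lfun2_Lfun1.
    by apply: Lfun_scale => //; rewrite ler1n.
  rewrite big_map mxE -sum_fine => [|j _]; last first.
    apply/expectation_fin_num/Lfun2_Lfun1.
    by apply: Lfun_scale => //; rewrite ler1n.
  apply: eq_bigr => j _; rewrite mxE expectationZl ?Lfun2_Lfun1// fineM//.
  by rewrite expectation_fin_num ?Lfun2_Lfun1.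
have lossE x : loss A eps0 y x = (\sum_(k < K) 'V_P[Z k] +
    (l2norm (A *m (x - (y - mean_vec eps0))) ^+ 2)%:E)%E.
  (* Change of variables from the law of [eps0] to [P]; the integrand is nonnegative, and [mI]
     supplies its measurability. *)
  have -> : loss A eps0 y x =
      'E_P[fun w => (\sum_(k < K) (Z k w - (A *m (y - x)) k 0) ^+ 2)%R]%E.
    have mI : measurable_fun [set: borel_cV R M] (fun e : borel_cV R M =>
        \sum_(k < K) ((A *m (e : 'cV[R]_M)) k 0 - (A *m (y - x)) k 0) ^+ 2).
      apply: measurable_sum => k; apply: measurable_funX.
      apply: measurable_funB => //.
      under eq_fun do rewrite mxE.
      apply: measurable_sum => j; apply: measurable_funM => //.
      exact: measurable_coord.
    have lE (e : 'cV[R]_M) : l2norm (phi A (x + e) - phi A y) ^+ 2 =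
        \sum_(k < K) ((A *m e) k 0 - (A *m (y - x)) k 0) ^+ 2.
      rewrite l2norm_sqr; apply: eq_bigr => k _.
      rewrite /phi mulmxDr mulmxBr !mxE.
      by congr (_ ^+ 2); ring.
    rewrite /loss unlock.
    under eq_integral do rewrite lE.
    rewrite ge0_integral_distribution//.
      exact/measurable_EFinP.
    by move=> e; rewrite lee_fin sumr_ge0// => k _; rewrite sqr_ge0.
  (* Sum and integral are exchanged by nonnegativity of the terms. *)
  transitivity (\sum_(k < K) 'E_P[fun w => ((Z k w - (A *m (y - x)) k 0) ^+ 2)%R])%E.
    rewrite unlock; under eq_integral do rewrite -sumEFin.
    rewrite ge0_integral_sum//.
    - move=> k; apply/measurable_EFinP; apply: measurable_funX.
      apply: measurable_funB => //.
      by move: (Z2 k); rewrite inE => /andP[/[!inE]].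
    - by move=> k w _; rewrite lee_fin sqr_ge0.
  rewrite l2norm_sqr -sumEFin -big_split/=; apply: eq_bigr => k _.
  rewrite expectation_sqrB_cst// EZ; congr (_ + (_ ^+ 2)%:E)%E.
  by rewrite !mulmxBr !mxE; ring.
(* This lets the constant cancel in comparisons of losses; were it infinite, every point would be a
   minimizer. *)
have Vfin : (\sum_(k < K) 'V_P[Z k])%E \is a fin_num.
  by apply/sum_fin_numP => k _ _; exact: variance_fin_num.
have l2norm0 : l2norm (0 : 'cV[R]_K) ^+ 2 = 0.
  by rewrite l2norm_sqr big1// => i _; rewrite mxE expr0n.
(* For uniqueness, a minimizer x is compared with y - E eps0 alone, where the quadratic term is 0;
   this forces |A (x - (y - E eps0))|^2 <= 0. *)
split=> [z|x /(_ (y - mean_vec eps0))];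
  rewrite !lossE leeD2lE// lee_fin subrr mulmx0 l2norm0 ?sqr_ge0//.
move=> A0; apply/esym/subr0_eq/A_inj; rewrite /phi mulmx0.
by apply: l2norm_sqr_eq0; apply/eqP; rewrite eq_le A0 sqr_ge0.
Qed.
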